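(* Let $\delta$ be a valley-free range map. The unital associative algebra $(\mathbf{Cl}_\delta,\cdot,\mathds{1})$ admits the presentation $\mathbb{K}\langle\mathbb{A}_{\mathcal{P}_\delta}\rangle/\mathcal{R}_\delta$, which fits into one of the following four classes: (i) if $\delta$ is of type A, then $\mathbb{A}_{\mathcal{P}_\delta}$ is finite and $\mathcal{R}_\delta$ is the zero space; (ii) if $\delta$ is of type B, then $\mathbb{A}_{\mathcal{P}_\delta}$ is infinite and $\mathcal{R}_\delta$ is the zero space; (iii) if $\delta$ is of type C, then $\mathbb{A}_{\mathcal{P}_\delta}$ is finite and $\mathcal{R}_\delta$ is finitely generated (as an ideal) and nonzero; (iv) if $\delta$ is of type D, then $\mathbb{A}_{\mathcal{P}_\delta}$ is infinite and $\mathcal{R}_\delta$ is infinitely generated (i.e. not finitely generated as an ideal).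
   Context: $\mathbb{K}$ is a field of characteristic zero, $\mathbb{N}=\{0,1,2,\dots\}$. A range map is a map $\delta:\mathbb{N}\setminus\{0\}\to\mathbb{N}$. It is valley-free if there are no $1\leq i_1<i_2<i_3$ with $\delta(i_1)>\delta(i_2)<\delta(i_3)$; weakly increasing if $\delta(i)\leq\delta(i+1)$ for all $i\geq1$; has an ascent (resp. a descent) if there are $1\leq i_1<i_2$ with $\delta(i_1)<\delta(i_2)$ (resp. $\delta(i_1)>\delta(i_2)$); is $1$-dominated if there is $k\geq1$ such that $\delta(1)\geq\delta(k')$ for all $k'\geq k$. Valley-free range maps are partitioned into: type A, the constant range maps; type B, the weakly increasing range maps having at least one ascent; type C, the $1$-dominated (valley-free) range maps having at least one descent; type D, the (valley-free) range maps that are not $1$-dominated and have at least one descent. A $\delta$-cliff is a finite word $u=u_1\cdots u_n$ of nonnegative integers with $u_i\leq\delta(i)$ for all $i$; $\mathsf{Cl}_\delta$ is the set of all of them, including the empty word $\epsilon$. $\mathbf{Cl}_\delta$ is the $\mathbb{K}$-vector space with basis $\{\mathsf{F}_u:u\in\mathsf{Cl}_\delta\}$. For a word $v\in\mathbb{N}^n$, $\mathrm{r}_\delta(v)_i:=\min\{v_i,\delta(i)\}$. The product is the bilinear map $\mathsf{F}_u\cdot\mathsf{F}_v=\sum_{v'}\mathsf{F}_{uv'}$, summed over all words $v'\in\mathbb{N}^{|v|}$ such that $\mathrm{r}_\delta(v')=v$ and $uv'\in\mathsf{Cl}_\delta$ ($uv'$ is the concatenation). The unit $\mathds{1}:\mathbb{K}\to\mathbf{Cl}_\delta$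 sends $1$ to $\mathsf{F}_\epsilon$. For valley-free $\delta$ this is a unital associative algebra. A nonempty $\delta$-cliff $u$ is $\delta$-prime if $u=vw$ (concatenation) with $v,w\in\mathsf{Cl}_\delta$ implies $v=\epsilon$ or $w=\epsilon$. $\mathcal{P}_\delta$ is the set of $\delta$-prime $\delta$-cliffs. $\mathbb{A}_{\mathcal{P}_\delta}=\{a_u:u\in\mathcal{P}_\delta\}$ is a set of noncommuting variables and $\mathbb{K}\langle\mathbb{A}_{\mathcal{P}_\delta}\rangle$ is the free unital associative algebra on it. $\mathcal{R}_\delta$ is the linear span of all monomials $a_{u^{(1)}}\cdots a_{u^{(k)}}$ with $k\geq1$, $u^{(i)}\in\mathcal{P}_\delta$ for all $i$, and such that the concatenation $u^{(1)}\cdots u^{(k)}$ is not in $\mathsf{Cl}_\delta$; for valley-free $\delta$ it is a two-sided ideal. *)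

(* Defs.v *)
From HB Require Import structures.
From mathcomp Require Import all_boot all_order all_algebra finmap.
From mathcomp Require Import zify.
From mathcomp Require Import boolp classical_sets cardinality.
From mathcomp.multinomials Require Import monalg.

Set Implicit Arguments.
Unset Strict Implicit.
Unset Printing Implicit Defensive.

Import GRing.Theory.
Local Open Scope classical_set_scope.
Local Open Scope ring_scope.

(* A range map is encoded as a function delta : nat -> nat whose value at 0    *)
(* is never used.  Words are 0-indexed sequences: the i-th letter u_i (i >= 1) *)
(* of u is nth 0 u i.-1.                                                       *)

Definition valley_free (delta : nat -> nat) : Prop :=
  forall i1 i2 i3 : nat, (1 <= i1)%N -> (i1 < i2)%N -> (i2 < i3)%N ->
    ~ ((delta i1 > delta i2)%N /\ (delta i2 < delta i3)%N).

Record vfrange := VFRange {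
  range_fun :> nat -> nat;
  range_valley_free : valley_free range_fun }.

Section RangeMapTypes.
Variable delta : nat -> nat.

Definition constant_range : Prop :=
  forall i j : nat, (1 <= i)%N -> (1 <= j)%N -> delta i = delta j.

Definition weakly_increasing : Prop :=
  forall i : nat, (1 <= i)%N -> (delta i <= delta i.+1)%N.

Definition has_ascent : Prop :=
  exists i1 i2 : nat, [/\ (1 <= i1)%N, (i1 < i2)%N & (delta i1 < delta i2)%N].

Definition has_descent : Prop :=
  exists i1 i2 : nat, [/\ (1 <= i1)%N, (i1 < i2)%N & (delta i1 > delta i2)%N].

Definition one_dominated : Prop :=
  exists2 k : nat, (1 <= k)%N &
    forall k' : nat, (k <= k')%N -> (delta k' <= delta 1)%N.

Definition typeA : Prop := constant_range.
Definition typeB : Prop := weakly_increasing /\ has_ascent.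
Definition typeC : Prop := [/\ valley_free delta, one_dominated & has_descent].
Definition typeD : Prop := [/\ valley_free delta, ~ one_dominated & has_descent].

End RangeMapTypes.

Section Cliffs.
Variable delta : nat -> nat.

Definition is_cliff (u : seq nat) : bool :=
  [forall i : 'I_(size u), (nth 0 u i <= delta i.+1)%N].

Record cliff := Cliff { cliff_word :> seq nat; _ : is_cliff cliff_word }.

HB.instance Definition _ := [isSub for cliff_word].
HB.instance Definition _ := [Choice of cliff by <:].

Lemma is_cliff_nil : is_cliff [::].
Proof. by apply/forallP => -[]. Qed.

Definition reduction (v : seq nat) : seq nat :=
  mkseq (fun i => minn (nth 0%N v i) (delta i.+1)) (size v).

Definition is_prime_cliff (u : cliff) : Prop :=
  u <> [::] :> seq nat /\
  forall v w : cliff, u = v ++ w :> seq nat ->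
    v = [::] :> seq nat \/ w = [::] :> seq nat.

Record prime_cliff := PrimeCliff {
  prime_val :> cliff; _ : `[< is_prime_cliff prime_val >] }.

HB.instance Definition _ := [isSub for prime_val].
HB.instance Definition _ := [Choice of prime_cliff by <:].

Definition max_range (n : nat) : nat := \max_(1 <= i < n.+1) delta i.

End Cliffs.

Section CliffProduct.
Variables (K : fieldType) (delta : nat -> nat).
Implicit Types (u v x : seq nat) (f g h : {malg K[cliff delta]}).

(* F_u; by convention 0 when the word u is not a delta-cliff. *)
Definition fundamental u : {malg K[cliff delta]} :=
  if insub u is Some c then << c >> else 0.

(* Since u v' has to be a delta-cliff, the letters of v' are at most           *)
(* max_range delta (size u + size v), so v' ranges over a finite type.         *)
Definition fundamental_mul u v : {malg K[cliff delta]} :=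
  \sum_(v' : (size v).-tuple 'I_(max_range delta (size u + size v)).+1
         | (reduction delta (map val v') == v)
           && is_cliff delta (u ++ map val v'))
     fundamental (u ++ map val v').

Definition cliff_mul f g : {malg K[cliff delta]} :=
  \sum_(u <- msupp f) \sum_(v <- msupp g)
     (f@_u * g@_v) *: fundamental_mul u v.

(* The coefficient of F_u in g, or 0 if the word u is not a delta-cliff. *)
Definition wcoeff g u : K := if insub u is Some c then g@_c else 0.

Lemma wcoeff_val g (c : cliff delta) : wcoeff g c = g@_c.
Proof. by rewrite /wcoeff valK. Qed.

Lemma wcoeffE g u :
  wcoeff g u = \sum_(c <- msupp g) g@_c * (u == c :> seq nat)%:R.
Proof.
rewrite /wcoeff; case: insubP => [c _ <-|ncu].
  have [cg|cg] := boolP (c \in msupp g); last first.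
    rewrite (mcoeff_outdom cg) big_seq big1 // => d dg.
    case: eqP => [/val_inj cd|]; last by rewrite mulr0.
    by move: cg; rewrite cd dg.
  rewrite (bigD1_seq c) //= eqxx mulr1 big1 ?addr0 // => d dc.
  by rewrite (inj_eq val_inj) eq_sym (negPf dc) mulr0.
rewrite big1 // => d _; case: eqP => [ud|]; last by rewrite mulr0.
by move: ncu; rewrite ud (valP d).
Qed.

Lemma is_cliffP u :
  reflect (forall i, (i < size u)%N -> (nth 0 u i <= delta i.+1)%N)
          (is_cliff delta u).
Proof.
apply: (iffP forallP) => [H i iu|H i]; first exact: (H (Ordinal iu)).
exact: H.
Qed.

Lemma is_cliff_take k x : is_cliff delta x -> is_cliff delta (take k x).
Proof.
move=> /is_cliffP cx; apply/is_cliffP => i.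
rewrite size_take_min ltn_min => /andP[ik ix]; rewrite nth_take //; exact: cx.
Qed.

Lemma size_reduction x : size (reduction delta x) = size x.
Proof. by rewrite size_mkseq. Qed.

Lemma nth_reduction x i : (i < size x)%N ->
  nth 0%N (reduction delta x) i = minn (nth 0%N x i) (delta i.+1).
Proof. by move=> ix; rewrite nth_mkseq. Qed.

Lemma is_cliff_reduction x : is_cliff delta (reduction delta x).
Proof.
apply/is_cliffP => i; rewrite size_reduction => ix.
by rewrite nth_reduction // geq_minr.
Qed.

Lemma reduction_id x : is_cliff delta x -> reduction delta x = x.
Proof.
move=> /is_cliffP cx; apply: (@eq_from_nth _ 0%N); rewrite size_reduction //.
by move=> i ix; rewrite nth_reduction //; apply/minn_idPl/cx.
Qed.

Lemma take_reduction k x :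
  take k (reduction delta x) = reduction delta (take k x).
Proof.
apply: (@eq_from_nth _ 0%N).
  by rewrite !(size_take_min, size_reduction).
move=> i; rewrite size_take_min size_reduction ltn_min => /andP[ik ix].
by rewrite nth_take // !nth_reduction ?nth_take // size_take_min ltn_min ik.
Qed.

Lemma fundamental_mulE u v (x : cliff delta) :
  (fundamental_mul u v)@_x =
  ((take (size u) x == u) && (reduction delta (drop (size u) x) == v))%:R.
Proof.
rewrite /fundamental_mul raddf_sum /=.
have basisE w : is_cliff delta w -> (fundamental w)@_x = (w == x)%:R.
  move=> cw; rewrite /fundamental insubT /= mcoeffU.
  by rewrite -(inj_eq val_inj).
under eq_bigr => t /andP[_ ct] do rewrite basisE //.
case: (boolP (_ && _)) => [/andP[/eqP tu /eqP dv]|nx]; last first.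
  rewrite big1 // => t /andP[/eqP tv _]; case: eqP => // xE.
  by move: nx; rewrite -xE take_size_cat // drop_size_cat // tv !eqxx.
have sx : size (drop (size u) x) = size v by rewrite -dv size_reduction.
have xE : u ++ drop (size u) x = x by rewrite -{1}tu cat_take_drop.
have bx a : a \in drop (size u) x ->
    (a < (max_range delta (size u + size v)).+1)%N.
  move=> /(nthP 0%N)[i]; rewrite sx => iv; rewrite nth_drop => <-.
  have/is_cliffP cx := valP x.
  apply: (leq_trans (n := (delta (size u + i).+1).+1)).
    rewrite ltnS; apply: cx.
    have -> : size x = (size u + size v)%N by rewrite -sx -size_cat xE.
    by rewrite ltn_add2l.
  rewrite ltnS /max_range; apply: leq_bigmax_seq => //.
  by rewrite mem_index_iota /= ltnS -addnS leq_add2l.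
have st : size [seq inord a : 'I_(max_range delta (size u + size v)).+1
                 | a <- drop (size u) x] == size v by rewrite size_map sx.
have tE : map val (Tuple st) = drop (size u) x.
  rewrite /= -map_comp -[RHS]map_id; apply/eq_in_map => a ax /=.
  by rewrite inordK // bx.
rewrite (bigD1 (Tuple st)) /=; last first.
  by rewrite tE dv eqxx xE (valP x).
rewrite tE xE eqxx big1 ?addr0 // => t /andP[_ nt].
case: eqP => // uE; case/eqP: nt; apply: val_inj => /=.
apply: (inj_map val_inj); rewrite -[RHS]/(map val (Tuple st)) tE.
by rewrite -uE drop_size_cat.
Qed.

Lemma cliff_mulE f g (x : cliff delta) :
  (cliff_mul f g)@_x =
  \sum_(k < (size x).+1)
     wcoeff f (take k x) * wcoeff g (reduction delta (drop k x)).
Proof.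
rewrite /cliff_mul raddf_sum /=.
transitivity (\sum_(u <- msupp f) f@_u *
   ((take (size u) x == u)%:R * wcoeff g (reduction delta (drop (size u) x)))).
  apply: eq_bigr => u _; rewrite raddf_sum /= wcoeffE !mulr_sumr.
  apply: eq_bigr => v _; rewrite mcoeffZ fundamental_mulE.
  by rewrite -mulnb natrM -!mulrA; congr (_ * _); rewrite mulrCA.
under [RHS]eq_bigr => k _ do rewrite wcoeffE mulr_suml.
rewrite exchange_big /=; apply: eq_bigr => u _.
under [RHS]eq_bigr => k _ do rewrite -mulrA.
rewrite -mulr_sumr; congr (_ * _).
case: eqP => [tu|ntu]; last first.
  rewrite mul0r big1 // => k _; case: eqP => [ku|]; last by rewrite mul0r.
  by case: ntu; rewrite -ku size_takel // -ltnS.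
have ux : (size u < (size x).+1)%N.
  by rewrite ltnS -tu size_take_min geq_minr.
rewrite (bigD1 (Ordinal ux)) //= tu eqxx big1 ?addr0 // => k nk.
case: eqP => [ku|]; last by rewrite mul0r.
case/eqP: nk; apply: val_inj => /=.
by rewrite -ku size_takel // -ltnS.
Qed.

Lemma cliff_mulEw f g x : is_cliff delta x ->
  wcoeff (cliff_mul f g) x =
  \sum_(0 <= k < (size x).+1)
     wcoeff f (take k x) * wcoeff g (reduction delta (drop k x)).
Proof.
move=> cx; rewrite -[x]/(val (Cliff cx)) wcoeff_val cliff_mulE.
by rewrite big_mkord.
Qed.

Lemma cliffalgP f g :
  (forall x, is_cliff delta x -> wcoeff f x = wcoeff g x) -> f = g.
Proof.
move=> fg; apply/malgP => c; rewrite -!wcoeff_val; exact/fg/valP.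
Qed.

Lemma wcoeffD f g x : wcoeff (f + g) x = wcoeff f x + wcoeff g x.
Proof. by rewrite /wcoeff; case: insub => [c|]; rewrite ?mcoeffD ?addr0. Qed.

Lemma wcoeffZ a g x : wcoeff (a *: g) x = a * wcoeff g x.
Proof. by rewrite /wcoeff; case: insub => [c|]; rewrite ?mcoeffZ ?mulr0. Qed.

Lemma wcoeff1 x : wcoeff (fundamental [::]) x = (x == [::])%:R.
Proof.
rewrite /fundamental (insubT _ (is_cliff_nil delta)) /= /wcoeff.
case: insubP => [c _ <-|ncx]; last by case: eqP ncx => // ->; rewrite is_cliff_nil.
by rewrite mcoeffU -(inj_eq val_inj) eq_sym.
Qed.

End CliffProduct.

Definition cliff_alg (K : fieldType) (delta : vfrange) : Type :=
  {malg K[cliff delta]}.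

Section CliffAlgebra.
Variables (K : fieldType) (delta : vfrange).
Implicit Types f g h : cliff_alg K delta.

HB.instance Definition _ := GRing.Lmodule.on (cliff_alg K delta).

Lemma reduction_drop_reduction j l (x : seq nat) : is_cliff delta x ->
  reduction delta (drop l (reduction delta (drop j x))) =
  reduction delta (drop (j + l) x).
Proof.
move=> /is_cliffP cx; apply: (@eq_from_nth _ 0%N).
  by rewrite !(size_reduction, size_drop) subnDA.
move=> i; rewrite !(size_reduction, size_drop) => il.
have ix : (j + l + i < size x)%N by lia.
rewrite nth_reduction; last by rewrite !(size_reduction, size_drop); lia.
rewrite [RHS]nth_reduction; last by rewrite size_drop; lia.
rewrite !nth_drop nth_reduction; last by rewrite size_drop; lia.
rewrite nth_drop addnA -minnA.
have := cx _ ix.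
have [d1 _|d1 xd] := leqP (delta i.+1) (delta (l + i).+1).
  by congr minn; apply/minn_idPr.
suff xd' : (nth 0 x (j + l + i) <= delta (l + i).+1)%N by lia.
apply: (leq_trans xd).
have [->|j0] := posnP j; first by [].
have l0 : (0 < l)%N by rewrite lt0n; apply/eqP => l0; move: d1; rewrite l0 ltnn.
rewrite leqNgt; apply/negP => d2.
apply: (range_valley_free (i1 := i.+1) (i2 := (l + i).+1)
  (i3 := (j + l + i).+1) _ _ _ (conj d1 d2)) => //; lia.
Qed.

Lemma cliff_mulA : associative (@cliff_mul K delta).
Proof.
move=> f g h; apply: cliffalgP => x cx.
rewrite !cliff_mulEw //.
pose F j k := wcoeff f (take j x)
  * wcoeff g (reduction delta (drop j (take k x)))
  * wcoeff h (reduction delta (drop k x)).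
transitivity (\sum_(0 <= j < (size x).+1)
                \sum_(0 <= k < (size x).+1 | (j <= k)%N) F j k).
  apply: eq_big_nat => j /andP[_ jx].
  rewrite cliff_mulEw ?is_cliff_reduction // size_reduction size_drop mulr_sumr.
  rewrite -(big_nat_widenl j 0%N _ predT) //.
  have -> : \sum_(j <= k < (size x).+1) F j k
          = \sum_(0 <= l < (size x - j).+1) F j (l + j)%N.
    by rewrite -{1}[j]add0n big_addn subSn.
  apply: eq_big_nat => l /andP[_ lx].
  rewrite reduction_drop_reduction // take_reduction take_drop mulrA.
  by rewrite /F [(l + j)%N]addnC.
under eq_bigr => j _ do rewrite big_mkcond.
rewrite exchange_big /=; apply: eq_big_nat => k /andP[_ kx].
rewrite cliff_mulEw ?is_cliff_take // mulr_suml size_takel -1?ltnS //.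
rewrite -big_mkcond /= [RHS](big_nat_widen _ _ (size x).+1) //.
apply: eq_big => j; first by rewrite ltnS.
by move=> jk; rewrite /F take_takel.
Qed.

Lemma cliff_mul1l : left_id (fundamental K delta [::]) (@cliff_mul K delta).
Proof.
move=> f; apply: cliffalgP => x cx; rewrite cliff_mulEw // big_nat_recl //.
rewrite take0 drop0 wcoeff1 eqxx mul1r reduction_id // big_nat big1 ?addr0 //.
move=> k /andP[_ kx]; rewrite wcoeff1 -size_eq0 size_takel // mul0r //.
Qed.

Lemma cliff_mulr1 : right_id (fundamental K delta [::]) (@cliff_mul K delta).
Proof.
move=> f; apply: cliffalgP => x cx; rewrite cliff_mulEw // big_nat_recr //=.
rewrite take_size drop_size wcoeff1 mulr1 big_nat big1 ?add0r // => k /andP[_ kx].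
rewrite wcoeff1 -size_eq0 size_reduction size_drop subn_eq0 leqNgt kx.
by rewrite mulr0.
Qed.

Lemma cliff_mulDl : left_distributive (@cliff_mul K delta) +%R.
Proof.
move=> f g h; apply: cliffalgP => x cx; rewrite wcoeffD !cliff_mulEw //.
by rewrite -big_split; apply: eq_bigr => k _; rewrite wcoeffD mulrDl.
Qed.

Lemma cliff_mulDr : right_distributive (@cliff_mul K delta) +%R.
Proof.
move=> f g h; apply: cliffalgP => x cx; rewrite wcoeffD !cliff_mulEw //.
by rewrite -big_split; apply: eq_bigr => k _; rewrite wcoeffD mulrDr.
Qed.

Lemma cliff_one_neq0 : fundamental K delta [::] != 0.
Proof.
apply/eqP => /(congr1 (fun f => wcoeff f [::])); rewrite wcoeff1 eqxx.
rewrite /wcoeff insubT ?is_cliff_nil //= => c; rewrite mcoeff0.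
exact/eqP/oner_neq0.
Qed.

HB.instance Definition _ := GRing.Zmodule_isNzRing.Build (cliff_alg K delta)
  cliff_mulA cliff_mul1l cliff_mulr1 cliff_mulDl cliff_mulDr cliff_one_neq0.

Lemma cliff_scaleAl (a : K) f g : a *: (f * g) = a *: f * g.
Proof.
apply: cliffalgP => x cx; rewrite wcoeffZ !cliff_mulEw // mulr_sumr.
by apply: eq_bigr => k _; rewrite wcoeffZ mulrA.
Qed.

Lemma cliff_scaleAr (a : K) f g : a *: (f * g) = f * (a *: g).
Proof.
apply: cliffalgP => x cx; rewrite wcoeffZ !cliff_mulEw // mulr_sumr.
by apply: eq_bigr => k _; rewrite wcoeffZ mulrCA.
Qed.

HB.instance Definition _ :=
  GRing.Lmodule_isLalgebra.Build K (cliff_alg K delta) cliff_scaleAl.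
HB.instance Definition _ :=
  GRing.Lalgebra_isAlgebra.Build K (cliff_alg K delta) cliff_scaleAr.

End CliffAlgebra.

Definition lspan (K : fieldType) (V : lmodType K) (S : set V) : set V :=
  [set x | exists n (c : 'I_n -> K) (s : 'I_n -> V),
     (forall i, S (s i)) /\ x = \sum_i c i *: s i].

Definition ideal_span (A : nzRingType) (S : set A) : set A :=
  [set x | exists n (a s b : 'I_n -> A),
     (forall i, S (s i)) /\ x = \sum_i a i * s i * b i].

Definition finitely_generated_ideal (A : nzRingType) (I : set A) : Prop :=
  exists2 S : set A, finite_set S & I = ideal_span S.

(* F / I is a presentation of A: a surjective morphism of unital associative   *)
(* algebras F -> A with kernel I, which induces an isomorphism F / I ~ A.      *)
Definition admits_presentation (K : fieldType) (F A : lalgType K) (I : set F) : Prop :=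
  exists2 phi : {lrmorphism F -> A},
    (forall y, exists x, phi x = y) & (forall x, phi x = 0 <-> I x).

Section Presentation.
Variables (K : fieldType) (delta : nat -> nat).

(* K<A_P>: the algebra of the free monoid on the delta-prime delta-cliffs. *)
Definition free_alg : Type := {malg K[{fmonom prime_cliff delta}]}.

HB.instance Definition _ := GRing.Lalgebra.on free_alg.

Definition concat (m : {fmonom prime_cliff delta}) : seq nat :=
  flatten [seq cliff_word (prime_val u) | u <- (m : seq (prime_cliff delta))].

Definition relations : set free_alg :=
  lspan [set x : free_alg | exists m : {fmonom prime_cliff delta},
    [/\ (1 <= fdeg m)%N, ~~ is_cliff delta (concat m) & x = << m >>]].

End Presentation.

Arguments relations : clear implicits.

(* Main.v *)
Require Import Defs.
From HB Require Import structures.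
From mathcomp Require Import all_boot all_order all_algebra finmap.
From mathcomp Require Import zify.
From mathcomp Require Import boolp classical_sets cardinality.
From mathcomp.multinomials Require Import monalg.

Set Implicit Arguments.
Unset Strict Implicit.
Unset Printing Implicit Defensive.

Import GRing.Theory.
Local Open Scope classical_set_scope.
Local Open Scope ring_scope.

(** The fundamental basis does not multiply by concatenation, but the sums
[upper_sum u] of the fundamental elements of all cliffs letterwise above [u]
do: if [v] is a cliff, the product of [upper_sum u] and [upper_sum v] is
[upper_sum (u ++ v)], which is zero if [u ++ v] is not a cliff ([upper_sumM],
[upper_sum_not_cliff]).  Sending each generator to the upper sum of its prime
cliff therefore defines a morphism from the free algebra which sends a monomial
to the upper sum of its concatenation.  It is onto, because upper sums are
unitriangular in the fundamental basis and every cliff is a product of prime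
cliffs.  It kills the forbidden monomials, those whose concatenation is not a
cliff, and nothing more: on the others it is injective, because upper sums of
cliffs are linearly independent and the factorization of a cliff into prime
cliffs is unique ([cliff_factorization_uniq]).  Uniqueness is where valleys
matter: a product of cliffs which is a suffix of a cliff is itself a cliff
([flatten_cliffs_suffix]).  The same fact makes the forbidden monomials an
ideal of monomials.

The classification depends on the eventual behaviour of [delta].

If [delta] is eventually equal to its minimum, from index [N + 1] on (types A
and C), then a suffix starting after [N] letters of a cliff is a cliff, so
prime cliffs have length at most [N], and a forbidden monomial with more than
[2 * N] factors stays forbidden when one of its first and last factors is removed.
This gives finitely many generators and finitely many relations.

If [delta] eventually exceeds its first value (types B and D), then the words
[delta 1, ..., delta n] are prime cliffs for all large [n], so there are
infinitely many generators.  For a weakly increasing [delta] (types A and B)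
products of cliffs are cliffs, so there are no relations.  In the presence of a
descent, a letter zero followed by the word [delta 1, ..., delta n] is not a
cliff for large [n]; when these words are prime (type D), this gives infinitely
many forbidden monomials of degree two.  As no forbidden monomial has degree
less than two, each of them must occur in a generator of the ideal. *)

Local Notation "1" := (@mone _) : monom_scope.
Local Notation "x * y" := (mmul x y) : monom_scope.

(** * Letterwise comparison of words *)

Section Words.
Implicit Types u v w : seq nat.

Lemma all2_leqP u v :
  reflect (size u = size v /\
           forall i, (i < size u)%N -> (nth 0%N u i <= nth 0%N v i)%N)
          (all2 leq u v).
Proof.
elim: u v => [|a u IH] [|b v] /=; try by constructor => // -[].
apply: (iffP andP) => [[ab /IH[-> uv]]|[[suv] uv]].
  by split=> // -[//|i]; apply: uv.
by split; [apply: (uv 0%N)|apply/IH; split=> // i; apply: (uv i.+1)].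
Qed.

Lemma all2_leq_sumn u v : all2 leq u v -> (sumn u <= sumn v)%N.
Proof.
by elim: u v => [|a u IH] [|b v] //= /andP[ab /IH uv]; apply: leq_add.
Qed.

Lemma all2_leq_sumn_eq u v : all2 leq u v -> sumn u = sumn v -> u = v.
Proof.
elim: u v => [|a u IH] [|b v] //= /andP[ab uv] s_uv.
have s_le := all2_leq_sumn uv.
have -> : a = b by lia.
by rewrite (IH v) //; lia.
Qed.

Lemma all2_leq_cat u1 u2 v1 v2 : size u1 = size v1 ->
  all2 leq (u1 ++ u2) (v1 ++ v2) = all2 leq u1 v1 && all2 leq u2 v2.
Proof. by elim: u1 v1 => [|a u IH] [|b v] //= [/IH ->]; rewrite andbA. Qed.

End Words.

(** * Valley-free range maps *)

Section RangeMaps.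
Variable delta : nat -> nat.

Lemma weakly_increasing_homo i j : weakly_increasing delta ->
  (1 <= i)%N -> (i <= j)%N -> (delta i <= delta j)%N.
Proof.
move=> wi i1 /subnK <-; elim: (j - i)%N => [//|k IH].
by apply: leq_trans IH _; apply: wi; lia.
Qed.

Lemma not_weakly_increasing : ~ weakly_increasing delta ->
  exists2 j, (1 <= j)%N & (delta j.+1 < delta j)%N.
Proof.
move=> nwi; apply: contrapT => nd; apply: nwi => i i1.
by rewrite leqNgt; apply/negP => di; apply: nd; exists i.
Qed.

Lemma has_descent_step : has_descent delta ->
  exists2 j, (1 <= j)%N & (delta j.+1 < delta j)%N.
Proof.
move=> [i1 [i2 [i1_gt0 i12 d12]]]; apply: not_weakly_increasing => wi.
have := weakly_increasing_homo wi i1_gt0 (ltnW i12).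
by rewrite leqNgt d12.
Qed.

Lemma range_map_type : valley_free delta ->
  [\/ typeA delta, typeB delta, typeC delta | typeD delta].
Proof.
move=> vf.
have [wi|/not_weakly_increasing[j j1 dj]] := pselect (weakly_increasing delta).
  have [asc|nasc] := pselect (has_ascent delta).
    by apply: Or42.
  apply: Or41; suff d1 k : (1 <= k)%N -> delta k = delta 1%N.
    by move=> i j /d1 -> /d1 ->.
  move=> k1; apply/eqP; rewrite eqn_leq (@weakly_increasing_homo 1 k) // andbT.
  rewrite leqNgt; apply/negP => d1k; apply: nasc; exists 1%N, k; split=> //.
  by rewrite ltn_neqAle k1 andbT; apply/eqP => k_eq1; rewrite -k_eq1 ltnn in d1k.
have desc : has_descent delta by exists j, j.+1; split.
by have [od|nod] := pselect (one_dominated delta); [apply: Or43|apply: Or44].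
Qed.

(** After a descent, a further increase would be the right side of a valley;
so the range map decreases and then stabilises.  Domination by [delta 1] puts
the final value below every earlier one, again by the absence of valleys. *)
Lemma typeC_stable : typeC delta -> exists2 N, (1 <= N)%N &
  forall i j, (N < i)%N -> (1 <= j)%N -> (delta i <= delta j)%N.
Proof.
move=> [vf [k k1 dom] [i1 [i2 [i1_gt0 i12 d12]]]].
pose N0 := maxn i2 k.
pose attained v := `[< exists2 i, (N0 < i)%N & delta i = v >].
have exP : exists v, attained v.
  by exists (delta N0.+1); apply/asboolP; exists N0.+1.
case: (ex_minnP exP) => c /asboolP[N N0N dN] minc.
have after i : (i2 < i)%N -> (delta i <= delta i2)%N.
  move=> ii; rewrite leqNgt; apply/negP => d.
  by apply: (vf i1 i2 i).
have stable i : (N < i)%N -> delta i = c.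
  move=> Ni; apply/eqP; rewrite eqn_leq; apply/andP; split; last first.
    by apply: minc; apply/asboolP; exists i => //; lia.
  rewrite leqNgt; apply/negP; rewrite -dN => d.
  have := after N; rewrite /N0 in N0N.
  by move=> aN; apply: (vf i1 N i); lia.
exists N; first by lia.
move=> i j Ni j1; rewrite (stable _ Ni) leqNgt; apply/negP => dj.
have [Nj|jN] := leqP N j.
  have [jN|Nj'] := eqVneq N j; first by rewrite -jN dN ltnn in dj.
  by rewrite stable ?ltnn // in dj; lia.
have d1 : (delta N <= delta 1)%N by apply: dom; rewrite /N0 in N0N; lia.
have [j_eq1|j_ne1] := eqVneq j 1%N; first by rewrite j_eq1 in dj; lia.
by apply: (vf 1%N j N); lia.
Qed.

(** As [delta 1] is exceeded again and again, an entry below [delta 1], or a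
return to [delta 1] after exceeding it, would be the bottom of a valley. *)
Lemma not_one_dominated_threshold : valley_free delta -> ~ one_dominated delta ->
  exists2 m, (1 <= m)%N & (forall i, (1 <= i <= m)%N -> delta i = delta 1) /\
                          (forall i, (m < i)%N -> (delta 1 < delta i)%N).
Proof.
move=> vf nod.
have large k : exists2 k', (k <= k')%N & (delta 1 < delta k')%N.
  apply: contrapT => nk; apply: nod; exists k.+1 => // k' kk'.
  rewrite leqNgt; apply/negP => d; apply: nk; exists k' => //; lia.
have ge1 i : (1 <= i)%N -> (delta 1 <= delta i)%N.
  move=> i1; rewrite leqNgt; apply/negP => d.
  have [k' ik' dk'] := large i.+1.
  have : i != 1%N by apply: contraTneq d => ->; rewrite ltnn.
  by move=> in1; apply: (vf 1%N i k'); lia.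
have exP : exists i, (1 <= i)%N && (delta 1 < delta i)%N.
  by have [k' k'1 dk'] := large 1%N; exists k'; rewrite k'1.
case: (ex_minnP exP) => p /andP[p1 dp] minp.
have pn1 : p != 1%N by apply: contraTneq dp => ->; rewrite ltnn.
exists p.-1; first by lia.
split=> i ip.
  apply/eqP; rewrite eqn_leq ge1 ?andbT; last by lia.
  rewrite leqNgt; apply/negP => di.
  by have : (p <= i)%N by [apply: minp; rewrite di; lia]; lia.
have [<-//|pi] := eqVneq p i.
rewrite ltnNge; apply/negP => di.
have [k' ik' dk'] := large i.+1.
by apply: (vf p i k'); lia.
Qed.

Lemma typeB_not_one_dominated : typeB delta -> ~ one_dominated delta.
Proof.
move=> [wi [i1 [i2 [i1_gt0 i12 d12]]]] [k k1 dom].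
have i2_gt0 : (1 <= i2)%N by lia.
have d1 := @weakly_increasing_homo 1 i1 wi isT i1_gt0.
have d2 := @weakly_increasing_homo i2 (maxn i2 k) wi i2_gt0 (leq_maxl _ _).
by have := dom _ (leq_maxr i2 k); lia.
Qed.

End RangeMaps.

(** * Cliffs and prime cliffs *)

Section CliffWords.
Variable delta : nat -> nat.
Implicit Types (u v w x y : seq nat) (s : seq (seq nat)) (p q : prime_cliff delta).

Lemma is_cliff_catl u v : is_cliff delta (u ++ v) -> is_cliff delta u.
Proof. by move=> /(is_cliff_take (size u)); rewrite take_size_cat. Qed.

Lemma is_cliff_below u v : all2 leq u v -> is_cliff delta v -> is_cliff delta u.
Proof.
move=> /all2_leqP[suv uv] /is_cliffP cv; apply/is_cliffP => i iu.
by apply: leq_trans (uv _ iu) (cv _ _); rewrite -suv.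
Qed.

Definition top_cliff n : seq nat := mkseq (fun i => delta i.+1) n.

Lemma is_cliff_top u : is_cliff delta u = all2 leq u (top_cliff (size u)).
Proof.
apply/is_cliffP/all2_leqP => [cu|[_ cu] i iu].
  by rewrite size_mkseq; split=> // i iu; rewrite nth_mkseq //; apply: cu.
by have := cu i iu; rewrite nth_mkseq.
Qed.

Lemma top_cliff_is_cliff n : is_cliff delta (top_cliff n).
Proof. by apply/is_cliffP => i; rewrite size_mkseq => i_n; rewrite nth_mkseq. Qed.

Lemma flatten_cliffs_nth s i : all (is_cliff delta) s ->
  (i < size (flatten s))%N ->
  exists2 j, (j <= i)%N & (nth 0%N (flatten s) i <= delta j.+1)%N.
Proof.
elim: s i => [//|u s IH] i /= /andP[/is_cliffP cu cs].
rewrite size_cat nth_cat; case: (ltnP i (size u)) => [iu _|ui iu].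
  by exists i => //; apply: cu.
have [|j ji yj] := IH (i - size u)%N cs; first by lia.
by exists j => //; lia.
Qed.

(** A letter of [flatten s] violating its bound at position [i] is bounded at
an earlier position, inside its own factor, and in [u ++ flatten s] at a later
one: this is a valley. *)
Lemma flatten_cliffs_suffix u s : valley_free delta ->
  all (is_cliff delta) s -> is_cliff delta (u ++ flatten s) ->
  is_cliff delta (flatten s).
Proof.
move=> vf cs /is_cliffP cus; apply/is_cliffP => i ii.
have [j ji yj] := flatten_cliffs_nth cs ii.
have := cus (size u + i)%N; rewrite size_cat ltn_add2l nth_cat.
rewrite [(_ < size u)%N]ltnNge leq_addr /= addKn => /(_ ii) ui.
rewrite leqNgt; apply/negP => di.
have j_ne : j != i by apply/eqP => jE; rewrite jE in yj; lia.
have u_ne : size u != 0%N by apply/eqP => u0; rewrite u0 add0n in ui; lia.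
by apply: (vf j.+1 i.+1 (size u + i).+1); lia.
Qed.

Lemma cliff_wordP (c : cliff delta) : is_cliff delta c.
Proof. exact: valP. Qed.

Lemma prime_cliff_neq0 p : (0 < size p)%N.
Proof. by case: p => c /= /asboolP[+ _]; rewrite lt0n size_eq0 => /eqP. Qed.

Lemma prime_cliff_drop p k : (0 < k < size p)%N -> ~~ is_cliff delta (drop k p).
Proof.
case: p => c /= /asboolP[_ primec] /andP[k0 kc]; apply/negP => cd.
have := primec (Cliff (is_cliff_take k (cliff_wordP c))) (Cliff cd).
rewrite /= cat_take_drop => /(_ erefl)[] /(congr1 size) /=.
  by rewrite size_takel ?(ltnW kc) //; lia.
by rewrite size_drop; lia.
Qed.

Lemma prime_cliffI u : is_cliff delta u -> (0 < size u)%N ->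
  (forall k, (0 < k < size u)%N -> ~~ is_cliff delta (drop k u)) ->
  exists p, p = u :> seq nat.
Proof.
move=> cu u0 ndrop.
suff pu : `[< is_prime_cliff (Cliff cu) >] by exists (PrimeCliff pu).
apply/asboolP; split=> [/= uE|v w /= uE]; first by rewrite uE in u0.
apply: contrapT => /not_orP[v0 w0].
have v_gt0 : (0 < size v)%N by rewrite lt0n size_eq0; apply/eqP.
have w_gt0 : (0 < size w)%N by rewrite lt0n size_eq0; apply/eqP.
have vu : (0 < size v < size u)%N by rewrite uE size_cat; lia.
by have /negP[] := ndrop _ vu; rewrite uE drop_size_cat //; apply: valP.
Qed.

Lemma prime_cliff_letter : exists p, p = [:: 0%N] :> seq nat.
Proof. by apply: prime_cliffI => // [|k /=]; [apply/is_cliffP => -[]|lia]. Qed.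

(** Cutting the top cliff after position [k <= m] puts the letter of index
[m + 1], which exceeds [delta 1], at an index where the bound is [delta 1];
cutting it later puts such a letter at index 1. *)
Lemma prime_top_cliff m n :
  (forall i, (1 <= i <= m)%N -> delta i = delta 1%N) ->
  (forall i, (m < i)%N -> (delta 1%N < delta i)%N) ->
  (m < n)%N -> exists p, p = top_cliff n :> seq nat.
Proof.
move=> low high mn; apply: prime_cliffI; first exact: top_cliff_is_cliff.
  by rewrite size_mkseq; lia.
rewrite size_mkseq => k /andP[k0 kn]; apply/negP => /is_cliffP cd.
have m0 : m != 0%N by apply/eqP => m0; move: (high 1%N); rewrite m0 ltnn => /(_ isT).
have := cd (m - k)%N; rewrite size_drop size_mkseq nth_drop nth_mkseq; last by lia.
have mk : (1 <= (m - k).+1 <= m)%N by lia.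
have := high (k + (m - k)).+1; rewrite (low _ mk) => hk ck.
by have := hk ltac:(lia); have := ck ltac:(lia); lia.
Qed.

End CliffWords.

(** * Factorization into prime cliffs *)

Section Monomials.
Variable delta : nat -> nat.
Implicit Types (u v w : seq nat) (p q : prime_cliff delta).
Implicit Types m : {fmonom prime_cliff delta}.

Lemma concat1 : concat (1%M : {fmonom prime_cliff delta}) = [::].
Proof. by rewrite /concat fm1. Qed.

Lemma concatM m1 m2 : concat (m1 * m2)%M = concat m1 ++ concat m2.
Proof. by rewrite /concat fmM map_cat flatten_cat. Qed.

Lemma concatU p : concat (fmu p) = p.
Proof. by rewrite /concat fmU /= cats0. Qed.

Lemma fmonom_cons p (s : seq (prime_cliff delta)) :
  FMonom (p :: s) = (fmu p * FMonom s)%M.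
Proof. by apply/eqP; rewrite fmP fmM fmU. Qed.

Lemma fmonom_ind (P : {fmonom prime_cliff delta} -> Prop) :
  P 1%M -> (forall p m, P m -> P (fmu p * m)%M) -> forall m, P m.
Proof.
move=> P1 PM [s]; elim: s => [|p s IH].
  by have <- : 1%M = FMonom [::] :> {fmonom prime_cliff delta}
    by apply/eqP; rewrite fmP fm1.
by rewrite fmonom_cons; apply: PM.
Qed.

Lemma leq_fdeg_concat m : (fdeg m <= size (concat m))%N.
Proof.
elim/fmonom_ind: m => [|p m IH]; first by rewrite fdeg1.
rewrite fdegM fdegU concatM concatU size_cat.
by have := prime_cliff_neq0 p; lia.
Qed.

(** For a valley-free [delta], these monomials correspond to the cliffs, by unique
factorization; they form a basis of the quotient by the relations. *)
Definition cliff_monom m := is_cliff delta (concat m).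

(** A factor on the right is removed because prefixes of cliffs are cliffs, one
on the left by [flatten_cliffs_suffix]. Equivalently, the forbidden monomials
are closed under multiplication by monomials. *)
Lemma cliff_monom_cut (vf : valley_free delta) m1 m m2 :
  cliff_monom (m1 * m * m2)%M -> cliff_monom m.
Proof.
rewrite /cliff_monom !concatM => /is_cliff_catl.
apply: flatten_cliffs_suffix => //.
by apply/allP => _ /mapP[p _ ->]; apply: cliff_wordP.
Qed.

Lemma not_cliff_monom_fdeg m : ~~ cliff_monom m -> (1 < fdeg m)%N.
Proof.
apply: contraR; case: m => [[|p [|q s]]] //= _.
  by rewrite /cliff_monom /concat is_cliff_nil.
by rewrite /cliff_monom /concat /= cats0; apply: cliff_wordP.
Qed.

Lemma cliff_factorization u : is_cliff delta u ->
  exists m : {fmonom prime_cliff delta}, concat m = u.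
Proof.
have [n] := ubnP (size u); elim: n u => // n IH u un cu.
have [u0|u0] := posnP (size u).
  by exists 1%M; rewrite concat1; apply/esym/size0nil.
have [[k [/andP[k0 ku] cd]]|irr] :=
    pselect (exists k, (0 < k < size u)%N /\ is_cliff delta (drop k u)).
  have [||m1 m1E] := IH (take k u); [by rewrite size_takel; lia|exact: is_cliff_take|].
  have [||m2 m2E] := IH (drop k u); [by rewrite size_drop; lia|exact: cd|].
  by exists (m1 * m2)%M; rewrite concatM m1E m2E cat_take_drop.
have [|p pE] := prime_cliffI cu u0; last by exists (fmu p); rewrite concatU.
by move=> k ku; apply/negP => cd; apply: irr; exists k.
Qed.

(** If one first prime factor were a proper prefix of the other, the rest of
the longer one would be a prefix of a suffix of the cliff which is a product
of cliffs, hence a cliff, against primality. *)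
Lemma cliff_factorization_uniq (vf : valley_free delta) m m' :
  cliff_monom m -> concat m = concat m' -> m = m'.
Proof.
have first_le p q m1 m2 : cliff_monom (fmu p * m1)%M ->
    p ++ concat m1 = q ++ concat m2 -> (size q <= size p)%N.
  move=> cpm E; rewrite leqNgt; apply/negP => pq.
  have := prime_cliff_drop (p := q) (k := size p).
  rewrite prime_cliff_neq0 pq => /(_ isT) /negP; apply.
  have cm1 : is_cliff delta (concat m1).
    by apply: (@cliff_monom_cut vf (fmu p) _ 1%M); rewrite mulm1.
  suff /(congr1 (take (size q - size p))) : concat m1 = drop (size p) q ++ concat m2.
    rewrite take_size_cat ?size_drop // => <-; exact: is_cliff_take.
  have /(congr1 (drop (size p))) := E; rewrite drop_size_cat // => ->.
  by rewrite drop_cat pq.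
elim/fmonom_ind: m m' => [|p m IH] m'; elim/fmonom_ind: m' => [|q m' _] //.
- move=> _ /(congr1 size); rewrite concatM concatU concat1 size_cat /=.
  by have := prime_cliff_neq0 q; lia.
- move=> _ /(congr1 size); rewrite concatM concatU concat1 size_cat /=.
  by have := prime_cliff_neq0 p; lia.
move=> cpm E; have cqm : cliff_monom (fmu q * m')%M by rewrite /cliff_monom -E.
have E' : p ++ concat m = q ++ concat m' by move: E; rewrite !concatM !concatU.
have spq : size p = size q.
  apply/eqP; rewrite eqn_leq (first_le _ _ _ _ cqm (esym E')).
  by rewrite (first_le _ _ _ _ cpm E').
have /eqP := E'; rewrite eqseq_cat // => /andP[/eqP pq /eqP mm'].
have -> : p = q by do 2![apply: val_inj].
by rewrite (IH m') //; apply: (@cliff_monom_cut vf (fmu p) _ 1%M); rewrite mulm1.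
Qed.

End Monomials.

(** * Forbidden monomials *)

Section Relations.
Variables (K : fieldType) (delta : nat -> nat).
Implicit Types (f : free_alg K delta) (m : {fmonom prime_cliff delta}).

Lemma relationsP f :
  relations K delta f <-> (forall m, m \in msupp f -> ~~ cliff_monom m).
Proof.
split=> [[n [c [s [badS ->]]]] m|bad].
  rewrite -mcoeff_neq0 raddf_sum /=; apply: contra => cm.
  rewrite big1 // => i _; have [m' [_ bad' ->]] := badS i.
  rewrite mcoeffZ mcoeffU; case: eqP => [mE|]; last by rewrite mulr0.
  by rewrite /cliff_monom -mE (negPf bad') in cm.
exists (size (msupp f)), (fun i => f@_(tnth (in_tuple (msupp f)) i)).
exists (fun i => << tnth (in_tuple (msupp f)) i >>); split=> [i|].
  have ncm : ~~ cliff_monom (tnth (in_tuple (msupp f)) i) by apply/bad/mem_tnth.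
  by eexists; split; [exact: ltnW (not_cliff_monom_fdeg ncm)|exact: ncm|by []].
rewrite {1}[f]monalgE big_tnth; apply: eq_bigr => i _.
by apply/malgP => m; rewrite mcoeffZ !mcoeffU mulr_natr.
Qed.

Lemma relationsU m : ~~ cliff_monom m -> relations K delta << m >>.
Proof. by move=> ncm; apply/relationsP => m'; rewrite msuppU1 inE => /eqP ->. Qed.

End Relations.

(** * A basis multiplying by concatenation *)

Section MultiplicativeBasis.
Variables (K : fieldType) (delta : nat -> nat).
Implicit Types u v w x y : seq nat.

(** The index [i] counts the letters already read, so that the first letter of
[u] has bound [delta i.+1]. *)
Fixpoint cliffs_above_from i u : seq (seq nat) :=
  if u is a :: u' then
    [seq b :: v | b <- iota a ((delta i.+1).+1 - a), v <- cliffs_above_from i.+1 u']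
  else [:: [::]].

Definition cliffs_above u := cliffs_above_from 0 u.

Lemma cliffs_above_from_uniq i u : uniq (cliffs_above_from i u).
Proof.
elim: u i => [//|a u IH] i /=; apply: allpairs_uniq => //; first exact: iota_uniq.
by move=> [b v] [b' v'] _ _ /= [-> ->].
Qed.

Lemma mem_cliffs_above_from i u w : w \in cliffs_above_from i u =
  all2 leq u w && all2 leq w (mkseq (fun k => delta (i + k).+1) (size w)).
Proof.
elim: u i w => [|a u IH] i [|b w] //.
  by apply/negbTE/allpairsP => -[[? ?] [_ _]].
have -> : all2 leq (b :: w) (mkseq (fun k => delta (i + k).+1) (size w).+1) =
    (b <= delta i.+1)%N && all2 leq w (mkseq (fun k => delta (i.+1 + k).+1) (size w)).
  rewrite /mkseq -[iota 0 _.+1]/(0%N :: iota 1 (size w)) /= addn0 (iotaDl 1 0) -map_comp.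
  by congr (_ && all2 leq w _); apply: eq_map => k /=; rewrite addnA addn1.
apply/allpairsP/idP => [[[b' w'] /= [+ + [-> ->]]]|].
  by rewrite mem_iota IH => ab /andP[-> ->]; rewrite andbT; lia.
move=> /andP[/andP[ab uw] /andP[bd wd]]; exists (b, w); split=> //=.
  by rewrite mem_iota; lia.
by rewrite IH; apply/andP.
Qed.

Lemma mem_cliffs_above u w :
  w \in cliffs_above u = all2 leq u w && is_cliff delta w.
Proof. by rewrite mem_cliffs_above_from is_cliff_top. Qed.

(** Summing over upper sets absorbs the reductions in the product of fundamental
elements, so that this family multiplies by concatenation. *)
Definition upper_sum u : {malg K[cliff delta]} :=
  \sum_(w <- cliffs_above u) fundamental K delta w.

Lemma wcoeff_fundamental u w : is_cliff delta u ->
  wcoeff (fundamental K delta u) w = (u == w)%:R.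
Proof.
move=> cu; rewrite /fundamental insubT /= /wcoeff; case: insubP => [c _ <-|ncw].
  by rewrite mcoeffU -(inj_eq val_inj).
by case: eqP => // uw; rewrite -uw cu in ncw.
Qed.

Lemma wcoeff_sum (I : Type) (r : seq I) (P : pred I) (F : I -> {malg K[cliff delta]}) w :
  wcoeff (\sum_(i <- r | P i) F i) w = \sum_(i <- r | P i) wcoeff (F i) w.
Proof.
elim/big_rec2: _ => [|i y z _ <-]; last exact: wcoeffD.
by rewrite /wcoeff; case: insub => // c; rewrite mcoeff0.
Qed.

Lemma wcoeff_upper_sum u w :
  is_cliff delta w -> wcoeff (upper_sum u) w = (all2 leq u w)%:R.
Proof.
move=> cw; rewrite /upper_sum wcoeff_sum.
under eq_big_seq => v.
  rewrite mem_cliffs_above => /andP[_ cv]; rewrite wcoeff_fundamental //.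
  over.
rewrite -natr_sum -(andbT (all2 leq u w)) -[X in _ && X]cw -mem_cliffs_above.
congr (_%:R); rewrite -(count_uniq_mem _ (cliffs_above_from_uniq 0 u)) -sum1_count.
by rewrite [RHS]big_mkcond.
Qed.

End MultiplicativeBasis.

Lemma upper_sum_not_cliff (K : fieldType) delta u :
  ~~ is_cliff delta u -> upper_sum K delta u = 0.
Proof.
move=> ncu; rewrite /upper_sum big_seq big1 // => w.
rewrite mem_cliffs_above => /andP[uw cw].
by rewrite (is_cliff_below uw cw) in ncu.
Qed.

(** * The presentation *)

Section Isomorphism.
Variables (K : fieldType) (delta : vfrange).
Implicit Types (u v w : seq nat) (m : {fmonom prime_cliff delta}).

Local Notation E u := (upper_sum K delta u : cliff_alg K delta).

Lemma upper_sum_nil : E [::] = 1.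
Proof. by rewrite /upper_sum big_seq1. Qed.

(** The terms of the product are the [u'v'] with [u <= u'] and
[v <= reduction v']; as [v] is a cliff, the latter means [v <= v']. *)
Lemma upper_sumM u v : is_cliff delta v -> E u * E v = E (u ++ v).
Proof.
move=> /is_cliffP cv; apply: cliffalgP => w cw.
rewrite cliff_mulEw // wcoeff_upper_sum //.
have redE x : all2 leq v (reduction delta x) = all2 leq v x.
  apply/all2_leqP/all2_leqP; rewrite size_reduction => -[sv vx]; split=> // i iv.
    by have := vx i iv; rewrite nth_reduction -?sv // leq_min => /andP[].
  by rewrite nth_reduction -?sv // leq_min vx // cv.
transitivity (\sum_(0 <= k < (size w).+1 | k == size u)
                 (all2 leq (u ++ v) w)%:R : K).
  rewrite [RHS]big_mkcond; apply: eq_big_nat => k /andP[_ kw].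
  rewrite !wcoeff_upper_sum ?is_cliff_take ?is_cliff_reduction // redE -natrM mulnb.
  have stk : size (take k w) = k by rewrite size_takel.
  case: eqP => [kE|nk]; last by case: (all2_leqP u (take k w)) => // -[]; rewrite stk => /esym.
  by rewrite -[in RHS](cat_take_drop k w) all2_leq_cat ?stk.
rewrite big_nat1_eq; case: ifP => // /negbT wu.
case: (all2_leqP (u ++ v) w) => // -[]; rewrite size_cat; lia.
Qed.


Definition concat_sum m : cliff_alg K delta := E (concat m).

(** The prime factors of [m2] are moved one at a time to the right end of [m1],
since [upper_sumM] asks for a cliff as right factor and the concatenation of
[m2] need not be one. *)
Lemma concat_sum_mmorphism : mmorphism concat_sum.
Proof.
split=> [m1 m2|]; last by rewrite /concat_sum concat1 upper_sum_nil.
elim/fmonom_ind: m2 m1 => [m1|p m2 IH m1].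
  by rewrite mulm1 /concat_sum concat1 upper_sum_nil mulr1.
have stepE m : concat_sum (m * fmu p)%M = concat_sum m * concat_sum (fmu p).
  by rewrite /concat_sum concatM concatU upper_sumM //; apply: cliff_wordP.
have -> : concat_sum (fmu p * m2)%M = concat_sum (fmu p) * concat_sum m2 by exact: IH.
by rewrite mulmA IH stepE mulrA.
Qed.

HB.instance Definition _ :=
  isMultiplicative.Build {fmonom prime_cliff delta} (cliff_alg K delta)
    concat_sum concat_sum_mmorphism.

Definition presentation_map : free_alg K delta -> cliff_alg K delta :=
  mmap (in_alg (cliff_alg K delta)) concat_sum.

Lemma presentation_map_additive : additive presentation_map.
Proof. exact: mmap_is_additive. Qed.

Lemma presentation_map_multiplicative : multiplicative presentation_map.
Proof.
apply: commr_mmap_is_multiplicative => g m m' /=.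
by rewrite /GRing.comm mulr_algl mulr_algr.
Qed.

Lemma presentation_map_scalable : scalable presentation_map.
Proof. by move=> a f; rewrite /presentation_map mmapZ /= mulr_algl. Qed.

HB.instance Definition _ :=
  GRing.isAdditive.Build _ _ presentation_map presentation_map_additive.
HB.instance Definition _ :=
  GRing.isMultiplicative.Build _ _ presentation_map presentation_map_multiplicative.
HB.instance Definition _ :=
  GRing.isScalable.Build _ _ _ _ presentation_map presentation_map_scalable.

Lemma presentation_mapU m : presentation_map << m >> = E (concat m).
Proof. by rewrite /presentation_map mmapU /= scale1r mul1r. Qed.

Lemma presentation_mapE f :
  presentation_map f = \sum_(m <- msupp f) f@_m *: E (concat m).
Proof.
rewrite /presentation_map mmapE; apply: eq_bigr => m _.
by rewrite /= mulr_algl.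
Qed.

(** Unitriangularity: [E u] is the fundamental element of [u] plus those of
cliffs of the same length with a larger letter sum, which is bounded by that of
the largest cliff of this length. *)
Lemma presentation_map_fundamental u : is_cliff delta u ->
  exists f, presentation_map f = fundamental K delta u.
Proof.
have [n] := ubnP (sumn (top_cliff delta (size u)) - sumn u).
elim: n u => // n IH u un cu.
have [m mE] := cliff_factorization cu.
have uu : u \in cliffs_above delta u.
  by rewrite mem_cliffs_above cu andbT; apply/all2_leqP.
have [g gE] : exists g, presentation_map g =
    \sum_(w <- rem u (cliffs_above delta u)) fundamental K delta w.
  rewrite big_seq; elim/big_ind: _ => [|_ _ [f1 <-] [f2 <-]|w].
  - by exists 0; rewrite raddf0.
  - by exists (f1 + f2); rewrite raddfD.
  rewrite mem_rem_uniq ?cliffs_above_from_uniq // inE mem_cliffs_above.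
  move=> /and3P[wu uw cw]; apply: IH => //.
  have sw : size w = size u by case/all2_leqP: uw.
  have := all2_leq_sumn uw; have := @all2_leq_sumn_eq _ _ uw.
  move: (cw); rewrite is_cliff_top sw => /all2_leq_sumn w_top.
  have : sumn u <> sumn w by move=> /(all2_leq_sumn_eq uw) uwE; rewrite uwE eqxx in wu.
  by move=> ? _ ?; lia.
exists (<< m >> - g); rewrite raddfB /= gE presentation_mapU mE /upper_sum.
by rewrite (big_rem u) //= addrK.
Qed.

Lemma presentation_map_surj (y : cliff_alg K delta) : exists f, presentation_map f = y.
Proof.
rewrite [y]monalgE; elim/big_ind: _ => [|_ _ [f1 <-] [f2 <-]|c _].
- by exists 0; rewrite raddf0.
- by exists (f1 + f2); rewrite raddfD.
have [f fE] := presentation_map_fundamental (cliff_wordP c).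
exists (y@_c *: f); rewrite linearZ /= fE /fundamental valK.
by apply/malgP => d; rewrite mcoeffZ !mcoeffU mulr_natr.
Qed.

(** If cliff monomials occurred in an element of the kernel, let [m] be one of
least letter sum. Any other monomial contributing to the coefficient at
[concat m] is a cliff monomial below [m], and equal to it by unique
factorization; so this coefficient is that of [m]. *)
Lemma presentation_map_ker f : presentation_map f = 0 <-> relations K delta f.
Proof.
split=> [f0|/relationsP bad]; last first.
  rewrite presentation_mapE big_seq big1 // => m /bad ncm.
  by rewrite upper_sum_not_cliff // scaler0.
apply/relationsP; apply: contrapT => /existsNP[m0 /not_implyP[m0f /negP]].
rewrite negbK => cm0.
pose P n := has (fun m => cliff_monom m && (sumn (concat m) == n)) (msupp f).
have exP : exists n, P n.
  by exists (sumn (concat m0)); apply/hasP; exists m0; rewrite ?cm0 /=.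
case: (ex_minnP exP) => n /hasP[m mf /andP[cm /eqP smn]] minn.
have /(congr1 (fun g : {malg _[_]} => wcoeff g (concat m))) := f0.
rewrite presentation_mapE wcoeff_sum.
have -> : wcoeff (0 : cliff_alg K delta) (concat m) = 0.
  by rewrite /wcoeff; case: insub => // c; rewrite mcoeff0.
rewrite (bigD1_seq m) ?fset_uniq //= wcoeffZ wcoeff_upper_sum //.
have -> : all2 leq (concat m) (concat m) by apply/all2_leqP.
rewrite mulr1 big_seq_cond big1 ?addr0 => [/eqP|m' /andP[m'f m'm]].
  by rewrite mcoeff_eq0 mf.
rewrite wcoeffZ wcoeff_upper_sum //.
have [le_m'|] := boolP (all2 leq (concat m') (concat m)); last by rewrite mulr0.
have cm' : cliff_monom m' := is_cliff_below le_m' cm.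
have le_n : (n <= sumn (concat m'))%N.
  by apply: minn; apply/hasP; exists m'; rewrite ?cm' /=.
have ge_n := all2_leq_sumn le_m'.
have /(cliff_factorization_uniq (@range_valley_free delta) cm') mm' : concat m' = concat m.
  by apply: all2_leq_sumn_eq => //; lia.
by rewrite mm' eqxx in m'm.
Qed.

Lemma cliff_alg_presentation :
  admits_presentation (cliff_alg K delta) (relations K delta).
Proof.
by exists presentation_map; [apply: presentation_map_surj|apply: presentation_map_ker].
Qed.

End Isomorphism.

(** * Finiteness of generators and relations *)

Lemma finite_bounded_seqs (T : choiceType) (A : set T) n : finite_set A ->
  finite_set [set s : seq T | (size s <= n)%N /\ {in s, forall x, A x}].
Proof.
move=> finA; elim: n => [|n IH].
  by apply: (sub_finite_set _ (finite_set1 [::])) => s [/=]; rewrite leqn0 size_eq0 => /eqP.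
have fin_cons := finite_image2 (fun x s => x :: s) finA IH.
apply: (@sub_finite_set _ _ ([set [::]] `|` _)) _ (_ : finite_set _); last first.
  by rewrite finite_setU; split; [exact: finite_set1|exact: fin_cons].
move=> [|x s] [/= sn As]; [by left|right].
exists x; first by apply: As; rewrite mem_head.
by exists s => //; split=> // y ys; apply: As; rewrite in_cons ys orbT.
Qed.

Lemma infinite_of_injective (T : Type) (A : set T) (f : nat -> T) :
  injective f -> (forall n, A (f n)) -> infinite_set A.
Proof.
move=> f_inj Af finA; apply: infinite_nat.
apply: sub_finite_set (finite_preimage _ finA) => [n _|]; first exact: Af.
by move=> x y _ _; apply: f_inj.
Qed.

Section Finiteness.
Variable delta : nat -> nat.
Implicit Types (p : prime_cliff delta) (m : {fmonom prime_cliff delta}).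

(** A suffix cut off after [N] letters keeps its letters below the least value
of [delta], so it is a cliff; a prime cliff has no room for one. *)
Lemma prime_cliff_size N p : (1 <= N)%N ->
  (forall i j, (N < i)%N -> (1 <= j)%N -> (delta i <= delta j)%N) ->
  (size p <= N)%N.
Proof.
move=> N1 stable; rewrite leqNgt; apply/negP => Np.
have /negP[] : ~~ is_cliff delta (drop N p) by apply: prime_cliff_drop; lia.
have /is_cliffP cp := cliff_wordP p.
apply/is_cliffP => i; rewrite size_drop => ip; rewrite nth_drop.
by apply: leq_trans (cp _ _) (stable _ _ _ _); lia.
Qed.

Lemma finite_prime_cliffs N : (1 <= N)%N ->
  (forall i j, (N < i)%N -> (1 <= j)%N -> (delta i <= delta j)%N) ->
  finite_set [set: prime_cliff delta].
Proof.
move=> N1 stable.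
have fin_letters : finite_set [set a : nat | (a <= max_range delta N)%N].
  by apply: sub_finite_set (finite_II (max_range delta N).+1) => a.
have fin_words := finite_bounded_seqs N fin_letters.
have word_inj : injective (fun p => cliff_word (prime_val p)).
  by move=> p q pq; do 2![apply: val_inj].
apply: sub_finite_set (finite_preimage (in2W word_inj) fin_words) => p _ /=.
have pN := prime_cliff_size p N1 stable; split=> // a /(nthP 0%N)[i ip <-].
have /is_cliffP cp := cliff_wordP p.
apply: leq_trans (cp i ip) _; rewrite /max_range; apply: leq_bigmax_seq => //.
by rewrite mem_index_iota; apply: leq_trans ip pN.
Qed.

Lemma finite_monoms n : finite_set [set: prime_cliff delta] ->
  finite_set [set m : {fmonom prime_cliff delta} | (fdeg m <= n)%N].
Proof.
move=> fin; have fin_seqs := finite_bounded_seqs n fin.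
by apply: sub_finite_set (finite_preimage (in2W val_inj) fin_seqs).
Qed.

(** In a long monomial, a letter violating its bound either occurs before the
last factor, or lies so far to the right that dropping the first factor does
not change the bound. *)
Lemma short_forbidden_factor N m : (1 <= N)%N ->
  (forall i j, (N < i)%N -> (1 <= j)%N -> (delta i <= delta j)%N) ->
  ~~ cliff_monom m ->
  exists m1 m0 m2, [/\ m = (m1 * m0 * m2)%M, ~~ cliff_monom m0 & (fdeg m0 <= 2 * N)%N].
Proof.
move=> N1 stable; have [n] := ubnP (fdeg m); elim: n m => // n IH m mn ncm.
have [mN|Nm] := leqP (fdeg m) (2 * N).
  by exists 1%M, m, 1%M; rewrite mulm1 mul1m.
have [[p [m' mE]] [m'' [q mE']]] : (exists p m', m = (fmu p * m')%M) /\
    (exists m' q, m = (m' * fmu q)%M).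
  case: m Nm {mn ncm} => [[|p s] //= _]; split.
    by exists p, (FMonom s); rewrite fmonom_cons.
  rewrite lastI; exists (FMonom (belast p s)), (last p s).
  by apply/eqP; rewrite fmP fmM fmU -cats1.
have [cm'|ncm'] := boolP (cliff_monom m'); last first.
  have [|m1 [m0 [m2 [m'E ncm0 m0N]]]] := IH m' _ ncm'.
    by move: mn; rewrite mE fdegM fdegU; lia.
  by exists (fmu p * m1)%M, m0, m2; rewrite mE m'E !mulmA.
have [cm''|ncm''] := boolP (cliff_monom m''); last first.
  have [|m1 [m0 [m2 [m''E ncm0 m0N]]]] := IH m'' _ ncm''.
    by move: mn; rewrite mE' fdegM fdegU; lia.
  by exists m1, m0, (m2 * fmu q)%M; rewrite mE' m''E !mulmA.
case/negP: ncm; apply/is_cliffP => i im.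
have [im''|m''i] := ltnP i (size (concat m'')).
  have /is_cliffP := cm''; rewrite mE' concatM nth_cat im''; exact.
have pN := prime_cliff_size p N1 stable.
have := leq_fdeg_concat m''; move: Nm; rewrite {1}mE' fdegM fdegU => Nm sm''.
have im' : (i - size p < size (concat m'))%N.
  by move: im; rewrite mE concatM concatU size_cat; lia.
have /is_cliffP/(_ _ im') := cm'.
rewrite mE concatM concatU nth_cat ifF; last by apply/negbTE; rewrite -leqNgt; lia.
by move=> le1; apply: leq_trans le1 (stable _ _ _ _); lia.
Qed.

End Finiteness.

Section Ideals.
Variables (K : fieldType) (delta : nat -> nat).
Implicit Types (m : {fmonom prime_cliff delta}) (S : set (free_alg K delta)).

Lemma mem_msupp_mul2 (f g h : free_alg K delta) m : m \in msupp (f * g * h) ->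
  exists m1 m0 m2, m0 \in msupp g /\ m = (m1 * m0 * m2)%M.
Proof.
move=> /msuppM_le[m' [m2 [/msuppM_le[m1 [m0 [_ m0g ->]]] _ ->]]].
by exists m1, m0, m2.
Qed.

Lemma sub_ideal_span S : S `<=` ideal_span S.
Proof.
move=> s Ss; exists 1%N, (fun=> 1), (fun=> s), (fun=> 1); split=> //.
by rewrite big_ord1 mul1r mulr1.
Qed.

Lemma mem_msupp_ideal_span S x m : ideal_span S x -> m \in msupp x ->
  exists s m1 m0 m2, [/\ S s, m0 \in msupp s & m = (m1 * m0 * m2)%M].
Proof.
move=> [n [a [s [b [Ss ->]]]]]; rewrite -mcoeff_neq0 raddf_sum /= => nz.
have [i nzi] : exists i, (a i * s i * b i)@_m != 0.
  apply: contrapT => /forallNP z; case/eqP: nz; rewrite big1 // => i _.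
  by apply/eqP; apply: contrapT => /negP; apply: z.
move: nzi; rewrite mcoeff_neq0 => /mem_msupp_mul2[m1 [m0 [m2 [m0s ->]]]].
by exists (s i), m1, m0, m2.
Qed.

Lemma relations_finitely_generated N : valley_free delta -> (1 <= N)%N ->
  (forall i j, (N < i)%N -> (1 <= j)%N -> (delta i <= delta j)%N) ->
  finitely_generated_ideal (relations K delta).
Proof.
move=> vf N1 stable.
pose S0 : set (free_alg K delta) := [set << m >> | m in
  [set m : {fmonom prime_cliff delta} | (fdeg m <= 2 * N)%N /\ ~~ cliff_monom m]].
exists S0.
  apply: finite_image; apply: sub_finite_set (finite_monoms (2 * N) _) => [m []//|].
  exact: finite_prime_cliffs stable.
rewrite eqEsubset; split=> [x /relationsP bad|x Sx]; last first.
  apply/relationsP => m mx.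
  have [_ [m1 [m0 [m2 [[m' [_ ncm'] <-] + ->]]]]] := mem_msupp_ideal_span Sx mx.
  rewrite msuppU1 inE => /eqP ->.
  by apply: contra ncm'; apply: cliff_monom_cut.
pose m_ := tnth (in_tuple (msupp x)).
have factor i : exists t : {fmonom prime_cliff delta} * {fmonom prime_cliff delta}
    * {fmonom prime_cliff delta},
    [/\ m_ i = (t.1.1 * t.1.2 * t.2)%M, ~~ cliff_monom t.1.2 & (fdeg t.1.2 <= 2 * N)%N].
  have [|m1 [m0 [m2 [mE ncm0 m0N]]]] := @short_forbidden_factor _ N (m_ i) N1 stable.
    exact/bad/mem_tnth.
  by exists (m1, m0, m2).
have [t tP] := choice factor.
exists (size (msupp x)), (fun i => << x@_(m_ i) *g (t i).1.1 >>),
  (fun i => << (t i).1.2 >>), (fun i => << (t i).2 >>); split=> [i|].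
  by have [_ ncm0 m0N] := tP i; exists (t i).1.2.
rewrite {1}[x]monalgE big_tnth; apply: eq_bigr => i _.
have [mE _ _] := tP i.
have mulU (c d : K) m1 m2 :
    << c *g m1 >> * << d *g m2 >> = << c * d *g (m1 * m2)%M >> :> free_alg K delta.
  rewrite (malgMEw (d1 := [fset m1]%fset) (d2 := [fset m2]%fset)) ?msuppU_le //.
  by rewrite !big_seq_fset1 !mcoeffUU.
by rewrite !mulU !mulr1 -mE.
Qed.

(** Forbidden monomials have degree at least two, so those of degree two have
no forbidden proper factor: each must occur in some generator. *)
Lemma relations_not_finitely_generated (m_ : nat -> {fmonom prime_cliff delta}) :
  injective m_ -> (forall n, fdeg (m_ n) = 2) ->
  (forall n, ~~ cliff_monom (m_ n)) ->
  ~ finitely_generated_ideal (relations K delta).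
Proof.
move=> m_inj m_deg m_bad [S finS relE].
apply: (@infinite_of_injective _ (\bigcup_(s in S) [set` msupp s]) m_) => //; last first.
  by apply: bigcup_finite => // s _; apply: finite_fset.
move=> n; have : relations K delta << m_ n >> by apply/relationsU.
rewrite relE => rel_n; have := @mem_msupp_ideal_span _ _ (m_ n) rel_n.
rewrite msuppU1 inE eqxx => /(_ isT)[s [m1 [m0 [m2 [Ss m0s mE]]]]].
exists s => //=; suff -> : m_ n = m0 by [].
have : relations K delta s by rewrite relE; apply: sub_ideal_span.
move=> /relationsP/(_ _ m0s)/not_cliff_monom_fdeg.
have := m_deg n; rewrite mE !fdegM => d d0.
have /fdeg_eq0I -> : fdeg m1 = 0%N by lia.
have /fdeg_eq0I -> : fdeg m2 = 0%N by lia.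
by rewrite mul1m mulm1.
Qed.

(** Each letter of a product of cliffs is bounded at an earlier position, inside
its own factor; an increasing [delta] allows it at any later one. *)
Lemma relations_eq0 : weakly_increasing delta -> relations K delta = [set 0].
Proof.
move=> wi; rewrite eqEsubset; split=> [x /relationsP bad|_ ->]; last first.
  by apply/relationsP => m; rewrite msupp0 inE.
apply/malgP => m; rewrite mcoeff0; apply/eqP; rewrite mcoeff_eq0.
apply/negP => /bad/negP; apply; apply/is_cliffP => i im.
have [|j ji yj] := flatten_cliffs_nth (delta := delta) _ im.
  by apply/allP => _ /mapP[p _ ->]; apply: cliff_wordP.
by apply: leq_trans yj _; apply: weakly_increasing_homo.
Qed.

End Ideals.

(** * Infinite families of prime cliffs and relations *)

Section TopCliffs.
Variable delta : nat -> nat.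

(** The shift moves the letter [delta j] to index [j + 1], where the bound is
smaller. *)
Lemma shifted_top_not_cliff j n : (1 <= j)%N -> (delta j.+1 < delta j)%N ->
  (j <= n)%N -> ~~ is_cliff delta (0%N :: top_cliff delta n).
Proof.
move=> j1 dj jn; apply/negP => /is_cliffP /(_ j); rewrite /= size_mkseq => /(_ jn).
by case: j j1 dj jn => // j _ dj jn /=; rewrite nth_mkseq //; lia.
Qed.

Lemma relations_neq0 (K : fieldType) : has_descent delta ->
  relations K delta <> [set 0].
Proof.
move=> /has_descent_step[j j1 dj].
have [m mE] := cliff_factorization (top_cliff_is_cliff delta j).
have [p pE] := prime_cliff_letter delta.
move=> rel0; have : relations K delta << (fmu p * m)%M >>.
  apply: relationsU; rewrite /cliff_monom concatM concatU mE pE.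
  exact: shifted_top_not_cliff (leqnn j).
by rewrite rel0 => /eqP; rewrite monalgU_eq0 oner_eq0.
Qed.

Lemma large_prime_top_cliffs : valley_free delta -> ~ one_dominated delta ->
  exists m, exists P : nat -> prime_cliff delta,
    forall k, P k = top_cliff delta (m + k).+1 :> seq nat.
Proof.
move=> vf nod; have [m m1 [low high]] := not_one_dominated_threshold vf nod.
have ex k : exists p : prime_cliff delta, p = top_cliff delta (m + k).+1 :> seq nat.
  by apply: prime_top_cliff low high _; lia.
by have [P PE] := choice ex; exists m, P.
Qed.

Lemma infinite_prime_cliffs : valley_free delta -> ~ one_dominated delta ->
  infinite_set [set: prime_cliff delta].
Proof.
move=> vf nod; have [m [P PE]] := large_prime_top_cliffs vf nod.
apply: (@infinite_of_injective _ _ P) => // k l /(congr1 (fun p : prime_cliff delta => size p)).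
by rewrite /= !PE !size_mkseq; lia.
Qed.

Lemma typeD_not_finitely_generated (K : fieldType) : typeD delta ->
  ~ finitely_generated_ideal (relations K delta).
Proof.
move=> [vf nod /has_descent_step[j j1 dj]].
have [m [P PE]] := large_prime_top_cliffs vf nod.
have [p pE] := prime_cliff_letter delta.
apply: (@relations_not_finitely_generated _ _ (fun k => (fmu p * fmu (P (j + k)%N))%M)).
- move=> k l /(congr1 (fun m => size (concat m))).
  by rewrite !concatM !concatU !PE !size_cat !size_mkseq; lia.
- by move=> k; rewrite fdegM !fdegU.
move=> k; rewrite /cliff_monom concatM !concatU PE pE.
by apply: shifted_top_not_cliff j1 dj _; lia.
Qed.

End TopCliffs.
(** * The classification *)

Theorem theorem3p2p11 (K : fieldType) (charK : [pchar K] =i pred0)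
    (delta : vfrange) :
  [/\ admits_presentation (cliff_alg K delta) (relations K delta),
      [\/ typeA delta, typeB delta, typeC delta | typeD delta]
    & [/\ typeA delta ->
            finite_set [set: prime_cliff delta] /\
            relations K delta = [set 0],
          typeB delta ->
            infinite_set [set: prime_cliff delta] /\
            relations K delta = [set 0],
          typeC delta ->
            [/\ finite_set [set: prime_cliff delta],
                finitely_generated_ideal (relations K delta)
              & relations K delta <> [set 0]]
        & typeD delta ->
            infinite_set [set: prime_cliff delta] /\
            ~ finitely_generated_ideal (relations K delta)]].
Proof.
have vf : valley_free delta := @range_valley_free delta.
split; [exact: cliff_alg_presentation|exact: range_map_type|split].
- move=> tA; split.
    apply: (@finite_prime_cliffs _ 1) => // i j i1 j1.
    by rewrite (tA i j) // ltnW.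
  by apply: relations_eq0 => i i1; rewrite (tA i i.+1).
- move=> tB; split; last by apply: relations_eq0; case: tB.
  by apply: infinite_prime_cliffs => //; apply: typeB_not_one_dominated.
- move=> tC; have [N N1 stable] := typeC_stable tC; split.
  + exact: finite_prime_cliffs stable.
  + exact: relations_finitely_generated stable.
  + by apply: relations_neq0; case: tC.
- move=> tD; split; last exact: typeD_not_finitely_generated.
  by apply: infinite_prime_cliffs => //; case: tD.
Qed.
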